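(* Let $A\in\mathscr{B}(\mathscr{H})$. Then \[ \omega(A)^2\le\frac12\inf_{0<t<1}\left(\left\|t|A|^{\frac2t}+(1-t)|A^*|^{\frac{2}{1-t}}\right\|^{\frac12}+\omega(A^2)\right). \]
   Context: $\mathscr{B}(\mathscr{H})$ is the $C^*$-algebra of all bounded linear operators on a complex Hilbert space $\mathscr{H}$ with inner product $\langle\cdot,\cdot\rangle$. For $T\in\mathscr{B}(\mathscr{H})$: $\omega(T)=\sup_{\|x\|=1}|\langle Tx,x\rangle|$ is the numerical radius and $\omega(T)^2$ means $(\omega(T))^2$; $\|T\|=\sup_{\|x\|=1}\|Tx\|$ is the operator norm; $T^*$ is the adjoint; $|T|=(T^*T)^{1/2}$. Real powers of positive operators are defined by the continuous functional calculus. *)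

(* Defs.v *)
From HB Require Import structures.
From mathcomp Require Import all_boot all_order all_algebra.
From mathcomp Require Import complex.
From mathcomp Require Import all_classical all_reals all_analysis.

Set Implicit Arguments.
Unset Strict Implicit.
Unset Printing Implicit Defensive.

Import Order.TTheory GRing.Theory Num.Theory.
Import numFieldNormedType.Exports.

Local Open Scope classical_set_scope.
Local Open Scope ring_scope.
Local Open Scope complex_scope.

(* In this development a complex Hilbert space is a complete normed space    *)
(* [H] over R[i] together with an inner product [dot], linear in its first   *)
(* and conjugate-linear in its second argument, satisfying [is_hilbert dot]. *)
(* Operators are functions [H -> H]; the norm of a normedModType over R[i]   *)
(* takes values in R[i], hence the uses of [complex.Re] to land in [R].      *)
Section Operators.
Variables (R : realType) (H : completeNormedModType R[i]).
Variable (dot : {dot H for (@Num.conj R[i])}).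
Implicit Types (S T P : H -> H) (z : R[i]).

Definition is_hilbert : Prop := forall x : H, dot x x = `|x| ^+ 2.

Definition bounded_op T : Prop := linear T /\ continuous T.

(* On the zero space there is no unit vector and both suprema below are 0,   *)
(* since [sup set0 = 0].                                                     *)
Definition opnorm T : R :=
  sup [set complex.Re `|T x| | x in [set x : H | `|x| = 1]].

Definition numrad T : R :=
  sup [set complex.Re `|dot (T x) x| | x in [set x : H | `|x| = 1]].

(* There is at most one such S, by definiteness of [dot]; existence for      *)
(* bounded T is the Riesz representation theorem.                            *)
Definition adjoint T : H -> H :=
  get [set S : H -> H | forall x y, dot (T x) y = dot x (S y)].

Definition spectrum T : set R[i] :=
  [set z | ~ exists S, [/\ bounded_op S,
     forall x, S (T x - z *: x) = x & forall x, T (S x) - z *: S x = x]].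

Definition polyop (p : {poly R[i]}) T : H -> H :=
  fun x => \sum_(i < size p) p`_i *: iter i T x.

(* Continuous functional calculus f(P) of a self-adjoint bounded P, as the   *)
(* continuous extension of the polynomial calculus from polynomials to the   *)
(* functions continuous on the spectrum: f(P) is the operator-norm limit of  *)
(* p_n(P) for every sequence of polynomials p_n converging to f uniformly on *)
(* the spectrum of P. By the Weierstrass theorem such sequences exist when f *)
(* is continuous on the (compact, real) spectrum, so that f(P) is then       *)
(* unique; the value is unspecified otherwise.                               *)
Definition cfc P (f : R[i] -> R[i]) : H -> H :=
  get [set T : H -> H | bounded_op T /\
    forall p : nat -> {poly R[i]},
      (forall e : R, 0 < e -> \forall n \near \oo,
         forall z, spectrum P z -> `|(p n).[z] - f z| < e%:C) ->
      opnorm (polyop (p n) P \- T) @[n --> \oo] --> (0 : R)].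

(* The real power P^r of a positive P, for r > 0: as the spectrum of P lies  *)
(* in the nonnegative reals, only the values at real z >= 0 matter.          *)
Definition oppow P (r : R) : H -> H :=
  cfc P (fun z => (complex.Re z `^ r)%:C).

Definition absop T : H -> H := oppow (adjoint T \o T) 2^-1.

End Operators.

(* Main.v *)
From HB Require Import structures.
Require Import Defs.
From mathcomp Require Import all_boot all_order all_algebra.
From mathcomp Require Import complex.
From mathcomp Require Import all_classical all_reals all_analysis.
From mathcomp Require Import ring lra.
Import Order.TTheory GRing.Theory Num.Theory.
Import numFieldNormedType.Exports.
Import ComplexField.Normc.
Local Open Scope classical_set_scope.
Local Open Scope ring_scope.
Local Open Scope complex_scope.

Set Implicit Arguments.
Unset Strict Implicit.
Unset Printing Implicit Defensive.

(** For a unit vector x, Buzano's inequality applied to A x and A^* x gives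
      2 |<A x, x>|^2 <= |A x| |A^* x| + |<A^2 x, x>|
    ([buzano]), so it is enough to bound the product |A x| |A^* x| by the square
    root of the norm of W = t |A|^(2/t) + (1-t) |A^*|^(2/(1-t)).  With X = |A x|^2
    and Y = |A^* x|^2, Young's inequality gives
      X Y <= t X^(1/t) + (1-t) Y^(1/(1-t)),
    and McCarthy's inequality, which is Jensen's inequality for the spectral
    measure of |A| at x, gives X^(1/t) <= <|A|^(2/t) x, x>, and likewise for A^*
    ([absop_jensen]).  Hence X Y <= <W x, x> <= |W|.

    The tangent line of v |-> v^(1/t) at X turns Jensen's inequality into the
    nonnegativity of f(|A|) for a function f that is nonnegative on the spectrum,
    a property of the continuous functional calculus of a positive operator P
    ([limit_add_poly_ge0]).  That calculus rests on

    - the bound |p(P)| <= sup |p| over the spectrum of P, for a polynomial p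
      ([polyop_norm_bound]).  Since |p(P) x|^2 = <(p^* p)(P) x, x>, this follows
      from two facts: the supremum of the numerical range of a symmetric operator
      belongs to its spectrum ([sup_numrange_spectrum]), and the spectrum of q(P)
      is contained in q of the spectrum of P ([spectral_mapping]);
    - the inclusion of the spectrum of P in [0, |P|] ([spectrum_positive]);
    - the uniform approximation of powers by Bernstein polynomials
      ([weierstrass]).

    One variational argument, the minimisation of <S x, x> - 2 f(x) for a coercive
    symmetric S ([coercive_representation]), gives both the existence of adjoints
    (with S the identity, this is the Riesz representation theorem) and the
    bounded inverses that locate the spectrum. *)

(** * Moduli and real parts of complex numbers *)
Section ComplexModulus.
Variable R : realType.
Implicit Types (z w : R[i]) (a : R).

Lemma norm_normc z : `|z| = (normc z)%:C. Proof. by []. Qed.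

Lemma normcR a : normc a%:C = `|a|.
Proof. by rewrite /= expr0n /= addr0 sqrtr_sqr. Qed.

Lemma normc_ge0 z : 0 <= normc z.
Proof. by case: z => a b; exact: sqrtr_ge0. Qed.

Lemma ler_Re_normc z : complex.Re z <= normc z.
Proof.
case: z => a b /=; apply: le_trans (ler_norm a) _.
by rewrite -sqrtr_sqr ler_sqrt ?addr_ge0 ?sqr_ge0// lerDl sqr_ge0.
Qed.

Lemma normc_conj z : normc (conjc z) = normc z.
Proof. by case: z => a b /=; rewrite sqrrN. Qed.

Lemma mul_conjc z : z * conjc z = (normc z ^+ 2)%:C.
Proof. by rewrite -sqr_normc rmorphXn. Qed.

Lemma conjcM z w : conjc (z * w) = conjc z * conjc w.
Proof. exact: rmorphM. Qed.

Lemma cReD z w : complex.Re (z + w) = complex.Re z + complex.Re w.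
Proof. by case: z; case: w. Qed.

Lemma cReN z : complex.Re (- z) = - complex.Re z.
Proof. by case: z. Qed.

Lemma cReZ a z : complex.Re (a%:C * z) = a * complex.Re z.
Proof. by case: z => x y /=; rewrite mul0r subr0. Qed.

Lemma cRe_conj z : complex.Re (conjc z) = complex.Re z.
Proof. by case: z. Qed.

Lemma natinv_lt a : 0 < a ->
  exists N, forall n, (N <= n)%N -> n.+1%:R^-1 < a.
Proof.
move=> a0; have [N _ hN] := @near_infty_natSinv_lt R (PosNum a0).
by exists N => n Nn; exact: hN.
Qed.
End ComplexModulus.

(** * Real-valued norm of a complex normed space *)
Section Geometry.
Variables (R : realType) (H : completeNormedModType R[i]).
Implicit Types (x y z : H) (a : R) (c : R[i]) (T : H -> H).

(** The norm of [H] takes values in R[i]; [nm] is the same number in [R], where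
    the order is total and real arithmetic applies. *)
Definition nm x : R := complex.Re `|x|.

Lemma nmE x : `|x| = (nm x)%:C.
Proof. by rewrite /nm RRe_real// ger0_real. Qed.

Lemma nm_ge0 x : 0 <= nm x.
Proof. by rewrite -ler0c -nmE. Qed.

Lemma nm0 : nm 0 = 0.
Proof. by rewrite /nm normr0. Qed.

Lemma nm_eq0 x : nm x = 0 -> x = 0.
Proof. by move=> x0; apply/normr0_eq0; rewrite nmE x0. Qed.

Lemma nm_gt0 x : x != 0 -> 0 < nm x.
Proof. by rewrite lt_def nm_ge0 andbT; apply: contra => /eqP/nm_eq0 ->. Qed.

Lemma nmN x : nm (- x) = nm x.
Proof. by rewrite /nm normrN. Qed.

Lemma nmBC x y : nm (x - y) = nm (y - x).
Proof. by rewrite /nm distrC. Qed.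

Lemma nmD x y : nm (x + y) <= nm x + nm y.
Proof. by rewrite -lecR rmorphD/= -!nmE ler_normD. Qed.

Lemma nmB x y : nm (x - y) <= nm x + nm y.
Proof. by rewrite -(nmN y) nmD. Qed.

Lemma nmZ c x : nm (c *: x) = normc c * nm x.
Proof. by apply: complexI; rewrite rmorphM/= -!nmE normrZ. Qed.

Lemma nm_triangle x y z : nm (x - z) <= nm (x - y) + nm (y - z).
Proof. by apply: le_trans (nmD _ _); rewrite addrA subrK. Qed.

Definition tends (u : nat -> H) x :=
  forall e, 0 < e -> exists N, forall n, (N <= n)%N -> nm (u n - x) < e.

Lemma cauchy_tends (u : nat -> H) :
  (forall e, 0 < e -> exists N, forall m n, (N <= m)%N -> (N <= n)%N ->
     nm (u m - u n) < e) ->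
  exists x, tends u x.
Proof.
move=> uC.
have : cauchy (u @ \oo).
  apply/cauchy_ballP => e e0.
  have [a aE] : exists a, e = a%:C.
    by exists (complex.Re e); rewrite RRe_real// gtr0_real.
  rewrite {}aE in e0 *; rewrite ltcR in e0.
  have [N hN] := uC _ e0.
  exists (u @` [set n | (N <= n)%N], u @` [set n | (N <= n)%N]).
    by split; exists N => //= n Nn; exists n.
  move=> [_ _] [[m Nm <-] [n Nn <-]].
  by rewrite -ball_normE /= nmE ltcR hN.
move=> /cauchy_cvg /cvg_ex [x ux]; exists x => e e0.
have [N _ hN] : \forall n \near \oo, `|x - u n| < e%:C.
  by move/cvgrPdist_lt : ux; apply; rewrite ltcR.
by exists N => n Nn; rewrite nmBC -ltcR -nmE; exact: hN.
Qed.

Lemma linB T x y : linear T -> T (x - y) = T x - T y.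
Proof.
move=> lT; have -> : x - y = -1 *: y + x by rewrite scaleN1r addrC.
by rewrite lT scaleN1r addrC.
Qed.

Lemma lin0 T : linear T -> T 0 = 0.
Proof. by move=> lT; have := linB 0 0 lT; rewrite !subrr. Qed.

Lemma linD T x y : linear T -> T (x + y) = T x + T y.
Proof. by move=> lT; have := lT 1 x y; rewrite !scale1r. Qed.

Lemma linZ T c x : linear T -> T (c *: x) = c *: T x.
Proof. by move=> lT; have := lT c x 0; rewrite (lin0 lT) !addr0. Qed.

Lemma linear_nm_continuous (T : H -> H) M : linear T ->
  (forall x, nm (T x) <= M * nm x) -> continuous T.
Proof.
move=> lT TM.
pose f : {linear H -> H} := HB.pack T (GRing.isLinear.Build _ _ _ _ T lT).
apply: (@bounded_linear_continuous _ _ _ f).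
apply/linear_boundedP; exists (M%:C); split; first by apply/complex_realP; exists M.
move=> r Mr x; apply: (@le_trans _ _ (M%:C * `|x|)).
  by rewrite !nmE -rmorphM/= lecR.
by apply: ler_wpM2r => //; exact: ltW.
Qed.

Lemma bounded_op_nm (T : H -> H) : bounded_op T ->
  exists2 M, 0 < M & forall x, nm (T x) <= M * nm x.
Proof.
move=> [lT cT].
pose f : {linear H -> H} := HB.pack T (GRing.isLinear.Build _ _ _ _ T lT).
have /linear_boundedP : bounded_near f (nbhs 0).
  by apply: continuous_linear_bounded; exact: cT.
move=> /pinfty_ex_gt0 [r r0 hr]; exists (complex.Re r).
  by rewrite -ltcR RRe_real// gtr0_real.
by move=> x; rewrite -lecR rmorphM/= -!nmE RRe_real ?gtr0_real// hr.
Qed.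

End Geometry.

(** * Inner product and Cauchy-Schwarz *)
Section InnerProduct.
Variables (R : realType) (H : completeNormedModType R[i]).
Variables (dot : {dot H for (@Num.conj R[i])}) (hH : is_hilbert dot).
Implicit Types (x y z : H) (a : R) (c : R[i]) (S T : H -> H).

(** The real part of the inner product is the inner product of [H] as a real
    Hilbert space; all quadratic estimates take place there. *)
Definition rdot x y : R := complex.Re (dot x y).
Local Notation ip := rdot.

Lemma dotC x y : dot y x = conjc (dot x y).
Proof. by rewrite hermC expr0 mul1r. Qed.

Lemma dotZl c x y : dot (c *: x) y = c * dot x y.
Proof. exact: linearZl_LR. Qed.

Lemma dotZr c x y : dot x (c *: y) = conjc c * dot x y.
Proof. exact: linearZr_LR. Qed.

Lemma ip_nm x : ip x x = nm x ^+ 2.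
Proof. by rewrite /rdot hH nmE -rmorphXn. Qed.

Lemma dot_nm x : dot x x = (nm x ^+ 2)%:C.
Proof. by rewrite hH nmE -rmorphXn. Qed.

Lemma ipC x y : ip x y = ip y x.
Proof. by rewrite /rdot dotC cRe_conj. Qed.

Lemma ipDl x y z : ip (x + y) z = ip x z + ip y z.
Proof. by rewrite /rdot linearDl cReD. Qed.

Lemma ipDr x y z : ip z (x + y) = ip z x + ip z y.
Proof. by rewrite ipC ipDl !(ipC z). Qed.

Lemma ipNl x z : ip (- x) z = - ip x z.
Proof. by rewrite /rdot linearNl cReN. Qed.

Lemma ipNr x z : ip z (- x) = - ip z x.
Proof. by rewrite ipC ipNl ipC. Qed.

Lemma ipBl x y z : ip (x - y) z = ip x z - ip y z.
Proof. by rewrite ipDl ipNl. Qed.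

Lemma ipBr x y z : ip z (x - y) = ip z x - ip z y.
Proof. by rewrite ipDr ipNr. Qed.

Lemma ipZl a x z : ip (a%:C *: x) z = a * ip x z.
Proof. by rewrite /rdot linearZl_LR cReZ. Qed.

Lemma ipZr a x z : ip z (a%:C *: x) = a * ip z x.
Proof. by rewrite ipC ipZl ipC. Qed.

Lemma nm_sqrD x y : nm (x + y) ^+ 2 = nm x ^+ 2 + 2 * ip x y + nm y ^+ 2.
Proof. rewrite -!ip_nm ipDl !ipDr (ipC y x); ring. Qed.

Lemma nm_sqrB x y : nm (x - y) ^+ 2 = nm x ^+ 2 - 2 * ip x y + nm y ^+ 2.
Proof. by rewrite nm_sqrD nmN ipNr mulrN. Qed.

(** Expand 0 <= |x - b y|^2 for the b that minimises it. *)
Lemma dot_le x y : normc (dot x y) <= nm x * nm y.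
Proof.
have [->|y0] := eqVneq y 0; first by rewrite linear0r normc0 nm0 mulr0.
have y1 := nm_gt0 y0.
rewrite -(@ler_pXn2r _ 2) ?nnegrE ?normc_ge0 ?mulr_ge0 ?nm_ge0// exprMn.
set c := dot x y; pose b : R[i] := ((nm y ^+ 2)^-1)%:C * c.
have y2 : nm y ^+ 2 != 0 by rewrite gt_eqF ?exprn_gt0.
have : 0 <= nm (x - b *: y) ^+ 2 by rewrite exprn_ge0 ?nm_ge0.
suff -> : nm (x - b *: y) ^+ 2 = nm x ^+ 2 - normc c ^+ 2 / nm y ^+ 2.
  by rewrite subr_ge0 ler_pdivrMr// exprn_gt0.
rewrite nm_sqrB nmZ exprMn.
have -> : ip x (b *: y) = normc c ^+ 2 / nm y ^+ 2.
  rewrite /rdot dotZr -/c /b conjcM conjc_real -mulrA cReZ.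
  by rewrite (mulrC _ c) mul_conjc mulrC.
rewrite /b normcM normcR ger0_norm ?invr_ge0 ?exprn_ge0 ?nm_ge0//.
by field; rewrite -(sqrf_eq0 (nm y)).
Qed.

Lemma ip_le x y : ip x y <= nm x * nm y.
Proof. exact: le_trans (ler_Re_normc _) (dot_le _ _). Qed.

Lemma ip_ge x y : - (nm x * nm y) <= ip x y.
Proof. by rewrite lerNl -ipNl -(nmN x) ip_le. Qed.

Lemma dot_ext x y : (forall z, dot z x = dot z y) -> x = y.
Proof.
move=> xy; apply/eqP; rewrite -subr_eq0 -(dnorm_eq0 dot).
by rewrite linearBr/= xy subrr.
Qed.

Lemma ip_ext x y : (forall z, ip z x = ip z y) -> x = y.
Proof.
move=> xy; apply/eqP; rewrite -subr_eq0; apply/eqP/nm_eq0/eqP.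
by rewrite -(sqrf_eq0 (nm _)) -ip_nm ipBr xy subrr.
Qed.

(** * Lax-Milgram for symmetric forms, by minimisation *)
Section Coercive.
Variables (S : H -> H) (k L : R).
Hypotheses (Slin : linear S) (Lpos : 0 < L) (Sbd : forall x, nm (S x) <= L * nm x).
Hypothesis Ssym : forall x y, ip (S x) y = ip x (S y).
Hypotheses (kpos : 0 < k) (Sco : forall x, k * nm x ^+ 2 <= ip (S x) x).
Variables (f : H -> R) (F : R).
Hypotheses (fD : forall x y, f (x + y) = f x + f y)
  (fZ : forall a x, f (a%:C *: x) = a * f x) (fbd : forall x, f x <= F * nm x).

Let SD x y := linD x y Slin.
Let SZ c x := linZ c x Slin.
Let SB x y := linB x y Slin.

(* Completing the square, [J x] is the squared distance, in the norm of the form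
   of [S], from [x] to the solution, up to a constant. *)
Let J x := ip (S x) x - 2 * f x.

Let JD x y : J (x + y) = J x + 2 * (ip (S x) y - f y) + ip (S y) y.
Proof. rewrite /J fD SD !ipDl !ipDr (ipC (S y) x) -Ssym; ring. Qed.

Let J_lb x : - (F ^+ 2 / k) <= J x.
Proof.
rewrite /J; have := Sco x; have := fbd x; move: (nm x) => n fx Sx.
suff : 0 <= k * n ^+ 2 - 2 * (F * n) + F ^+ 2 / k by lra.
have -> : k * n ^+ 2 - 2 * (F * n) + F ^+ 2 / k = (k * n - F) ^+ 2 / k.
  by field; rewrite gt_eqF.
by rewrite divr_ge0 ?sqr_ge0 ?ltW.
Qed.

(** The parallelogram identity for the form of [S] makes every minimising sequence
    of [J] a Cauchy sequence; at its limit the first variation of [J] vanishes,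
    which is the claim.  With [S] the identity this is Riesz' theorem, with
    [f y = ip y z] it is the surjectivity of [S]. *)
Lemma coercive_representation : exists x, forall y, f y = ip y (S x).
Proof.
pose E := [set J x | x in [set: H]].
have E0 : has_inf E.
  split; first by exists (J 0); exists 0.
  by exists (- (F ^+ 2 / k)) => _ [x _ <-]; exact: J_lb.
pose m := inf E.
have mJ x : m <= J x by apply: (ge_inf E0.2); exists x.
have ex n : exists x, J x < m + n.+1%:R^-1.
  have [|_ [x _ <-] ?] := @inf_adherent _ E (n.+1%:R^-1) _ E0.
    by rewrite invr_gt0 ltr0n.
  by exists x.
have /choice [u uJ] := ex.
(* compare [J x] and [J y] with the value of [J] at the midpoint *)
have par x y : k * nm (x - y) ^+ 2 <= 2 * (J x - m) + 2 * (J y - m).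
  apply: le_trans (Sco _) _.
  have := mJ (2^-1%:C *: (x + y)); rewrite /J.
  rewrite !(SB, SZ, fZ, SD, ipBl, ipBr, ipDl, ipDr, ipZl, ipZr, fD).
  rewrite (ipC (S y) x) -(Ssym x y) => h; lra.
have uC : forall e : R, 0 < e -> exists N, forall p q : nat, (N <= p)%N -> (N <= q)%N ->
    nm (u p - u q) < e.
  move=> e e0.
  have [N hN] : exists N : nat, 4 * N.+1%:R^-1 < k * e ^+ 2.
    have ke : 0 < k * e ^+ 2 / 4 by rewrite divr_gt0// mulr_gt0// exprn_gt0.
    have [N hN] := natinv_lt ke.
    by exists N; have := hN N (leqnn _); rewrite ltr_pdivlMr// mulrC.
  exists N => p q Np Nq.
  rewrite -(@ltr_pXn2r _ 2) ?nnegrE ?nm_ge0 ?ltW//.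
  rewrite -(ltr_pM2l kpos); apply: le_lt_trans (par _ _) (le_lt_trans _ hN).
  have inv_le n : (N <= n)%N -> n.+1%:R^-1 <= N.+1%:R^-1 :> R.
    by move=> Nn; rewrite lef_pV2 ?posrE ?ltr0n// ler_nat.
  have := uJ p; have := uJ q; have := inv_le _ Np; have := inv_le _ Nq.
  move: (N.+1%:R^-1) (p.+1%:R^-1) (q.+1%:R^-1) (J (u p)) (J (u q)) => *; lra.
have [x ux] := cauchy_tends uC.
have Jx : J x <= m.
  apply/ler_addgt0Pr => e e0.
  pose B := 2 * (L * nm x + `|F|) + 1.
  have B0 : 0 < B.
    rewrite /B; have := mulr_ge0 (ltW Lpos) (nm_ge0 x); have := normr_ge0 F; lra.
  have e2 : 0 < e / 2 by rewrite divr_gt0.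
  have [N1 hN1] := ux _ (divr_gt0 e2 B0).
  have [N2 hN2] := natinv_lt e2.
  pose n := maxn N1 N2.
  have : nm (u n - x) * B < e / 2 by rewrite -ltr_pdivlMr// hN1 ?leq_maxl.
  have := hN2 n (leq_maxr _ _); have := uJ n; move: (n.+1%:R^-1) => i.
  have := JD x (u n - x); rewrite (addrC x) subrK; move: (J (u n)) => Jn.
  move: (u n - x) => d.
  have := ip_ge (S x) d; have := fbd d; have := Sco d.
  have : nm (S x) * nm d <= (L * nm x) * nm d.
    by rewrite ler_wpM2r ?nm_ge0.
  have : 0 <= k * nm d ^+ 2 by rewrite mulr_ge0 ?exprn_ge0 ?nm_ge0 ?ltW.
  have : F * nm d <= `|F| * nm d by rewrite ler_wpM2r ?nm_ge0 ?ler_norm.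
  have := nm_ge0 d.
  have -> : nm d * B = 2 * (L * nm x * nm d + `|F| * nm d) + nm d.
    by rewrite /B; ring.
  lra.
exists x => y.
(* The variation of [J] in direction [y] is quadratic in the step; the step
   [- D / Q] would strictly decrease [J] unless [D = 0]. *)
pose D := ip (S x) y - f y; pose Q := L * nm y ^+ 2 + 1.
have Qy : ip (S y) y <= L * nm y ^+ 2.
  apply: le_trans (ip_le _ _) _; rewrite expr2 mulrA.
  by rewrite ler_wpM2r ?nm_ge0.
have Q0 : 0 < Q.
  have : 0 <= L * nm y ^+ 2 by rewrite mulr_ge0 ?exprn_ge0 ?nm_ge0 ?ltW.
  rewrite /Q; lra.
have := le_trans Jx (mJ (x + (- D / Q)%:C *: y)).
rewrite JD SZ fZ !ipZl !ipZr.
have -> : J x + 2 * (- D / Q * ip (S x) y - - D / Q * f y) +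
    - D / Q * (- D / Q * ip (S y) y) =
    J x - (D / Q) ^+ 2 * (2 * Q - ip (S y) y).
  by rewrite /D; field; rewrite gt_eqF.
rewrite lerDl oppr_ge0 => h.
have DQ : (D / Q) ^+ 2 = 0.
  apply/eqP; rewrite eq_le sqr_ge0 andbT -(pmulr_lle0 _ (_ : 0 < 2 * Q - ip (S y) y))//.
  rewrite /Q in Q0 *; lra.
move/eqP : DQ; rewrite sqrf_eq0 mulf_eq0 invr_eq0 (gt_eqF Q0) orbF subr_eq0.
by move=> /eqP <-; rewrite ipC.
Qed.
End Coercive.
End InnerProduct.

(** * Bounded operators and inverses *)
Section Operators.
Variables (R : realType) (H : completeNormedModType R[i]).
Implicit Types (x y z : H) (a b : R) (c : R[i]) (S T V : H -> H).

Lemma bounded_opP T : linear T -> (exists M, forall x, nm (T x) <= M * nm x) ->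
  bounded_op T.
Proof. by move=> lT [M TM]; split=> //; exact: linear_nm_continuous TM. Qed.

Lemma bounded_op_id : bounded_op (@id H).
Proof. by apply: bounded_opP => //; exists 1 => x; rewrite mul1r. Qed.

Lemma bounded_op_comp S T :
  bounded_op S -> bounded_op T -> bounded_op (fun x => S (T x)).
Proof.
move=> bS bT; have [M M0 hM] := bounded_op_nm bS.
have [N N0 hN] := bounded_op_nm bT.
apply: bounded_opP => [c x y|]; first by rewrite bT.1 bS.1.
by exists (M * N) => x; rewrite -mulrA (le_trans (hM _))// ler_wpM2l// ltW.
Qed.

Lemma bounded_op_add S T :
  bounded_op S -> bounded_op T -> bounded_op (fun x => S x + T x).
Proof.
move=> bS bT; have [M M0 hM] := bounded_op_nm bS.
have [N N0 hN] := bounded_op_nm bT.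
apply: bounded_opP => [c x y|].
  by rewrite bT.1 bS.1 scalerDr !addrA; congr (_ + _); rewrite addrAC.
exists (M + N) => x; rewrite mulrDl (le_trans (nmD _ _))// lerD//.
Qed.

Lemma bounded_op_scale c T : bounded_op T -> bounded_op (fun x => c *: T x).
Proof.
move=> bT; have [N N0 hN] := bounded_op_nm bT.
apply: bounded_opP => [d x y|].
  by rewrite bT.1 scalerDr !scalerA mulrC.
by exists (normc c * N) => x; rewrite nmZ -mulrA ler_wpM2l ?normc_ge0.
Qed.

Lemma bounded_op_sub S T :
  bounded_op S -> bounded_op T -> bounded_op (fun x => S x - T x).
Proof.
move=> bS bT.
have := bounded_op_add bS (bounded_op_scale (-1) bT).
by congr bounded_op; apply/funext => x; rewrite scaleN1r.
Qed.

Lemma bounded_op_shift T c : bounded_op T -> bounded_op (fun x => T x - c *: x).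
Proof.
move=> bT; apply: bounded_op_sub => //; apply: bounded_op_scale.
exact: bounded_op_id.
Qed.

(** [spectrum T c] is the negation of [exists V, inverse_op V (T - c)]. *)
Definition inverse_op V T :=
  [/\ bounded_op V, forall x, V (T x) = x & forall x, T (V x) = x].

Lemma inverse_op_comp V S W T :
  inverse_op V S -> inverse_op W T ->
  inverse_op (fun x => W (V x)) (fun x => S (T x)).
Proof.
move=> [bV VS SV] [bW WT TW]; split; first exact: bounded_op_comp.
  by move=> x; rewrite VS WT.
by move=> x; rewrite TW SV.
Qed.

Lemma inverse_op_scale c V T : c != 0 -> linear T ->
  inverse_op V T -> inverse_op (fun x => c^-1 *: V x) (fun x => c *: T x).
Proof.
move=> c0 lT [bV VT TV]; split; first exact: bounded_op_scale.
  by move=> x; rewrite (linZ _ _ bV.1) VT scalerA mulVf// scale1r.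
by move=> x; rewrite linZ// TV scalerA mulfV// scale1r.
Qed.

Lemma not_spectrumP T c :
  ~ spectrum T c <-> exists V, inverse_op V (fun x => T x - c *: x).
Proof. by split=> [/contrapT//|h]; apply. Qed.

Lemma nm_normalize x : x != 0 -> nm (((nm x)^-1)%:C *: x) = 1.
Proof.
move=> x0; have n0 : nm x != 0 by apply: contra x0 => /eqP/nm_eq0 ->.
by rewrite nmZ normcR ger0_norm ?invr_ge0 ?nm_ge0// mulVf.
Qed.

End Operators.

(** * Adjoints and the spectrum of a symmetric operator *)
Section Hilbert.
Variables (R : realType) (H : completeNormedModType R[i]).
Variables (dot : {dot H for (@Num.conj R[i])}) (hH : is_hilbert dot).
Implicit Types (x y z : H) (a b : R) (c : R[i]) (S T V P : H -> H).
Local Notation ip := (rdot dot).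

(** The imaginary part of the inner product is recovered from the real part by
    replacing [x] by i x. *)
Lemma dot_of_ip T S : linear T ->
  (forall x y, ip (T x) y = ip x (S y)) -> forall x y, dot (T x) y = dot x (S y).
Proof.
move=> lT TS x y; apply/eqP; rewrite eq_complex; apply/andP; split.
  by apply/eqP; exact: TS.
have := TS ('i%C *: x) y; rewrite /rdot linZ// !dotZl.
case: (dot (T x) y) (dot x (S y)) => p q [r s] /=.
by rewrite !mul0r !mul1r !sub0r => /oppr_inj ->.
Qed.

Lemma adjoint_exists T : bounded_op T ->
  exists S, forall x y, dot (T x) y = dot x (S y).
Proof.
move=> bT; have [M M0 hM] := bounded_op_nm bT.
have ex y : exists w, forall x, ip (T x) y = ip x w.
  apply: (@coercive_representation _ _ dot hH id 1 1 _ _ _ _ _ _ _ (M * nm y)) => //.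
  - by move=> x; rewrite mul1r.
  - by move=> x; rewrite mul1r ip_nm.
  - by move=> x z; rewrite (linD _ _ bT.1) ipDl.
  - by move=> a x; rewrite (linZ _ _ bT.1) ipZl.
  - move=> x; apply: le_trans (ip_le hH _ _) _.
    by rewrite mulrAC ler_wpM2r ?nm_ge0.
have /choice [S hS] := ex.
by exists S => x y; apply: dot_of_ip bT.1 _ x y => x y; exact: hS.
Qed.

Lemma adjointP T : bounded_op T ->
  forall x y, dot (T x) y = dot x (adjoint dot T y).
Proof.
move=> bT; have [S hS] := adjoint_exists bT.
exact: (@getPex _ [set S : H -> H | forall x y, dot (T x) y = dot x (S y)]
  (ex_intro _ S hS)).
Qed.

Lemma adjointPr T : bounded_op T ->
  forall x y, dot (adjoint dot T x) y = dot x (T y).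
Proof. by move=> bT x y; rewrite dotC -adjointP// -dotC. Qed.

Lemma bounded_op_adjoint T : bounded_op T -> bounded_op (adjoint dot T).
Proof.
move=> bT; have [M M0 hM] := bounded_op_nm bT.
apply: bounded_opP => [c x y|].
  apply: (dot_ext (dot := dot)) => z; rewrite -adjointP//.
  by rewrite !linearDr/= !dotZr -!adjointP.
exists M => x; have [->|] := eqVneq (nm (adjoint dot T x)) 0.
  by rewrite mulr_ge0 ?nm_ge0 ?ltW.
move=> n0; have {}n0 : 0 < nm (adjoint dot T x) by rewrite lt_def n0 nm_ge0.
rewrite -(ler_pM2r n0) -expr2 -(ip_nm hH) /rdot -adjointP// mulrAC.
by apply: le_trans (ip_le hH _ _) _; rewrite ler_wpM2r ?nm_ge0.
Qed.

Definition symop S := forall x y, dot (S x) y = dot x (S y).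

Lemma symop_ip S x y : symop S -> ip (S x) y = ip x (S y).
Proof. by rewrite /rdot => ->. Qed.

(** The quadratic form of a symmetric operator is real. *)
Lemma symop_dot S x : symop S -> dot (S x) x = (ip (S x) x)%:C.
Proof.
move=> sS; have := dotC dot (S x) x; rewrite -(sS x x) /rdot.
by case: (dot (S x) x) => p q [/eqP]; rewrite eq_sym eqNr => /eqP ->.
Qed.

(** Coercivity gives injectivity and the bound 1/k on the inverse;
    [coercive_representation] gives surjectivity. *)
Lemma coercive_inverse S k : bounded_op S -> symop S -> 0 < k ->
  (forall x, k * nm x ^+ 2 <= ip (S x) x) -> exists V, inverse_op V S.
Proof.
move=> bS sS k0 hk; have [L L0 hL] := bounded_op_nm bS.
have inj x y : S x = S y -> x = y.
  move=> xy; apply/eqP; rewrite -subr_eq0; apply/eqP/nm_eq0/eqP.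
  rewrite -(sqrf_eq0 (nm _)) eq_le sqr_ge0 andbT -(pmulr_rle0 _ k0).
  by apply: le_trans (hk _) _; rewrite linB ?xy ?subrr ?/rdot ?linear0l//; exact: bS.1.
have ex y : exists x, S x = y.
  have [|||x hx] := @coercive_representation _ _ dot hH S k L bS.1 L0 hL
    (fun x y => symop_ip x y sS) k0 hk (fun x => ip x y) (nm y).
  - by move=> x z; rewrite ipDl.
  - by move=> a x; rewrite ipZl.
  - by move=> x; rewrite mulrC ip_le.
  by exists x; apply: (ip_ext hH (dot := dot)) => z; rewrite hx.
have /choice [V hV] := ex.
exists V; split=> [|x|//]; last by apply: inj; rewrite hV.
apply: bounded_opP => [c x y|].
  by apply: inj; rewrite bS.1 !hV.
exists k^-1 => x; rewrite ler_pdivlMl//.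
have [->|] := eqVneq (nm (V x)) 0; first by rewrite mulr0 nm_ge0.
move=> n0; have {}n0 : 0 < nm (V x) by rewrite lt_def n0 nm_ge0.
rewrite -(ler_pM2r n0) -mulrA -expr2; apply: le_trans (hk _) _.
by rewrite hV ip_le.
Qed.

(** A point at positive distance from the numerical range is not in the spectrum:
    B = P - c and its adjoint B' are bounded below by k, so B' B is coercive and
    (B' B)^-1 B' is a two-sided inverse of B. *)
Lemma resolvent_numrange P c k : bounded_op P -> symop P -> 0 < k ->
  (forall x, k * nm x ^+ 2 <= normc (dot (P x - c *: x) x)) -> ~ spectrum P c.
Proof.
move=> bP sP k0 hk; apply/not_spectrumP.
pose B x := P x - c *: x; pose B' x := P x - conjc c *: x.
have bB : bounded_op B by exact: bounded_op_shift.
have bB' : bounded_op B' by exact: bounded_op_shift.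
have adj x y : dot (B x) y = dot x (B' y).
  by rewrite /B /B' linearBl linearBr/= sP dotZl dotZr conjcK.
have adj' x y : dot (B' x) y = dot x (B y) by rewrite dotC -adj -dotC.
have low W x : k * nm x ^+ 2 <= normc (dot (W x) x) -> k * nm x <= nm (W x).
  move=> h; have [->|] := eqVneq (nm x) 0; first by rewrite mulr0 nm_ge0.
  move=> n0; have {}n0 : 0 < nm x by rewrite lt_def n0 nm_ge0.
  rewrite -(ler_pM2r n0) -mulrA -expr2; apply: le_trans h _; exact: dot_le.
have lowB x : k * nm x <= nm (B x) by apply: low; exact: hk.
have lowB' x : k * nm x <= nm (B' x).
  by apply: low; rewrite adj' dotC normc_conj; exact: hk.
have [||V [bV VS SV]] := @coercive_inverse (fun x => B' (B x)) (k ^+ 2)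
    (bounded_op_comp bB' bB) _ (exprn_gt0 2 k0).
- by move=> x y; rewrite adj' adj.
- move=> x; rewrite /rdot adj' -/(rdot _ _ _) ip_nm// -exprMn.
  by rewrite ler_pXn2r ?nnegrE ?lowB ?mulr_ge0 ?nm_ge0 ?ltW.
exists (fun x => V (B' x)); split=> [|x|x]; first exact: bounded_op_comp.
  exact: VS.
apply/eqP; rewrite -subr_eq0; apply/eqP/nm_eq0/eqP.
rewrite eq_le nm_ge0 andbT -(pmulr_rle0 _ k0); apply: le_trans (lowB' _) _.
by rewrite (linB _ _ bB'.1) SV subrr nm0.
Qed.

(** The distance from c to the numerical range of P is at least |Im c|, - Re c and
    Re c - M, so none of these is positive when c is in the spectrum. *)
Lemma spectrum_positive P M c : bounded_op P -> symop P ->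
  (forall x, 0 <= ip (P x) x) -> (forall x, nm (P x) <= M * nm x) ->
  spectrum P c -> exists2 a, 0 <= a <= M & c = a%:C.
Proof.
move=> bP sP P0 PM sc.
have PM' x : ip (P x) x <= M * nm x ^+ 2.
  by rewrite expr2 mulrA (le_trans (ip_le hH _ _))// ler_wpM2r ?nm_ge0.
have dotE x : dot (P x - c *: x) x =
    (ip (P x) x - complex.Re c * nm x ^+ 2) +i* (- (complex.Im c * nm x ^+ 2)).
  rewrite linearBl/= dotZl symop_dot// dot_nm//; case: (c) => p q /=.
  by rewrite /real_complex_def; simpc.
have out k : 0 < k ->
  (forall x, k * nm x ^+ 2 <= `|ip (P x) x - complex.Re c * nm x ^+ 2|) \/
  (forall x, k * nm x ^+ 2 <= `|complex.Im c * nm x ^+ 2|) -> False.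
  move=> k0 h; apply: (resolvent_numrange bP sP k0) sc => x; rewrite dotE.
  have [{}h|{}h] := h; apply: le_trans (h x) _ => /=.
    by rewrite -sqrtr_sqr ler_sqrt ?addr_ge0 ?sqr_ge0// lerDl sqr_ge0.
  by rewrite -normrN -sqrtr_sqr ler_sqrt ?addr_ge0 ?sqr_ge0// lerDr sqr_ge0.
have Im0 : complex.Im c = 0.
  apply/eqP/negPn/negP => i0; apply: (out `|complex.Im c|); first by rewrite normr_gt0.
  by right=> x; rewrite normrM (ger0_norm (sqr_ge0 _)).
exists (complex.Re c); last by case: (c) Im0 => p q /= ->.
rewrite leNgt [_ <= M]leNgt; apply/andP; split; apply/negP => h.
  apply: (out (- complex.Re c)); first by rewrite oppr_gt0.
  by left=> x; apply: le_trans (ler_norm _); have := P0 x; lra.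
apply: (out (complex.Re c - M)); first by rewrite subr_gt0.
left=> x; rewrite distrC; apply: le_trans (ler_norm _); have := PM' x; lra.
Qed.

(** Nonnegativity of the quadratic form of [S] at [x - L^-1 S x]. *)
Lemma positive_nm_sqr S L x : bounded_op S -> symop S ->
  (forall x, 0 <= ip (S x) x) -> 0 < L -> (forall x, nm (S x) <= L * nm x) ->
  nm (S x) ^+ 2 <= L * ip (S x) x.
Proof.
move=> bS sS S0 L0 SL.
have := S0 (x - (L^-1)%:C *: S x).
rewrite (linB _ _ bS.1) (linZ _ _ bS.1) !ipBl !ipBr !ipZl !ipZr.
rewrite (symop_ip (S x) x sS) !ip_nm//.
have h : ip (S (S x)) (S x) <= L * nm (S x) ^+ 2.
  by rewrite expr2 mulrA (le_trans (ip_le hH _ _))// ler_wpM2r ?nm_ge0.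
have h2 : L^-1 * (L^-1 * ip (S (S x)) (S x)) <= L^-1 * nm (S x) ^+ 2.
  by rewrite ler_pM2l ?invr_gt0// mulrC ler_pdivrMr// mulrC.
rewrite -ler_pdivrMl// => h3; lra.
Qed.

Lemma ip_le_sup_numrange T x : bounded_op T -> nm x = 1 ->
  ip (T x) x <= sup [set ip (T x) x | x in [set x | nm x = 1]].
Proof.
move=> bT x1; have [M M0 hM] := bounded_op_nm bT.
apply: ub_le_sup; last by exists x.
exists M => _ [y /= y1 <-]; apply: le_trans (ip_le hH _ _) _.
by rewrite y1 mulr1 (le_trans (hM _))// y1 mulr1.
Qed.

(** Let S = m - T for the supremum m.  A bounded inverse of S would keep |S x|, hence
    <S x, x> by [positive_nm_sqr], away from 0 on unit vectors, contradicting the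
    definition of m. *)
Lemma sup_numrange_spectrum T x0 : bounded_op T -> symop T -> nm x0 = 1 ->
  spectrum T (sup [set ip (T x) x | x in [set x | nm x = 1]])%:C.
Proof.
move=> bT sT x01; set E := [set _ | _ in _]; set m := sup E.
have Em x : nm x = 1 -> ip (T x) x <= m by exact: ip_le_sup_numrange.
pose S x := m%:C *: x - T x.
have bS : bounded_op S.
  by apply: bounded_op_sub => //; apply: bounded_op_scale; exact: bounded_op_id.
have sS : symop S.
  by move=> x y; rewrite /S linearBl linearBr/= sT dotZl dotZr conjc_real.
have ipS x : ip (S x) x = m * nm x ^+ 2 - ip (T x) x.
  by rewrite /S ipBl ipZl ip_nm.
have S0 x : 0 <= ip (S x) x.
  have [->|x0'] := eqVneq x 0; first by rewrite /rdot linear0r.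
  have := Em _ (nm_normalize x0').
  have n0 := nm_gt0 x0'.
  rewrite (linZ _ _ bT.1) ipZl ipZr mulrA -expr2 exprVn mulrC.
  by rewrite ler_pdivrMr ?exprn_gt0// ipS subr_ge0.
have [L L0 SL] := bounded_op_nm bS.
apply: contrapT => /not_spectrumP [V [bV VT TV]].
have [C C0 hC] := bounded_op_nm bV.
have low x : nm x = 1 -> ip (T x) x <= m - (C ^+ 2 * L)^-1.
  move=> x1.
  have h1 : 1 <= C * nm (S x).
    rewrite -{1}x1 -{1}(VT x); apply: le_trans (hC _) _.
    by rewrite /S nmBC.
  have h2 : 1 <= C ^+ 2 * L * ip (S x) x.
    rewrite -mulrA; apply: le_trans (_ : C ^+ 2 * nm (S x) ^+ 2 <= _).
      by rewrite -exprMn -(expr1n _ 2) ler_pXn2r ?nnegrE ?h1 ?mulr_ge0 ?nm_ge0 ?ltW.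
    by rewrite ler_wpM2l ?sqr_ge0//; exact: positive_nm_sqr.
  have : (C ^+ 2 * L)^-1 <= ip (S x) x.
    by rewrite -[_^-1]mulr1 ler_pdivrMl// mulr_gt0// exprn_gt0.
  by rewrite ipS x1 expr1n mulr1; move: (_^-1) => i; lra.
have : m <= m - (C ^+ 2 * L)^-1.
  by apply: ge_sup => [|_ [x x1 <-]]; [by exists (ip (T x0) x0); exists x0|exact: low].
by rewrite lerBrDl gerDr leNgt invr_gt0 mulr_gt0// exprn_gt0.
Qed.

End Hilbert.

(** * Polynomial calculus and spectral mapping *)
Section Polynomials.
Variables (R : realType) (H : completeNormedModType R[i]).
Implicit Types (x y z : H) (a b : R) (c : R[i]) (S T V P : H -> H).
Implicit Types (p q : {poly R[i]}).

Lemma polyop_widen p T x n : (size p <= n)%N ->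
  polyop p T x = \sum_(i < n) p`_i *: iter i T x.
Proof.
move=> pn; rewrite /polyop (big_ord_widen n (fun i => p`_i *: iter i T x) pn).
rewrite big_mkcond /=; apply: eq_bigr => i _; case: ifPn => // /negbTE.
by rewrite ltnNge => /negbFE pi; rewrite nth_default// scale0r.
Qed.

Lemma polyopD p q T x : polyop (p + q) T x = polyop p T x + polyop q T x.
Proof.
pose n := maxn (size p) (size q).
rewrite (@polyop_widen p _ _ n) ?leq_maxl// (@polyop_widen q _ _ n) ?leq_maxr//.
rewrite (@polyop_widen (p + q) _ _ n) ?size_polyD// -big_split/=.
by apply: eq_bigr => i _; rewrite coefD scalerDl.
Qed.

Lemma polyopZ c p T x : polyop (c *: p) T x = c *: polyop p T x.
Proof.
rewrite (@polyop_widen (c *: p) _ _ (size p)) ?size_scale_leq// scaler_sumr.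
by apply: eq_bigr => i _; rewrite coefZ scalerA.
Qed.

Lemma polyopB p q T x : polyop (p - q) T x = polyop p T x - polyop q T x.
Proof. by rewrite polyopD -scaleN1r polyopZ scaleN1r. Qed.

Lemma polyopC c T x : polyop c%:P T x = c *: x.
Proof.
rewrite (@polyop_widen _ _ _ 1) ?size_polyC_leq1//.
by rewrite big_ord_recl big_ord0 coefC /= addr0.
Qed.

Lemma polyop_mulX p T x : polyop (p * 'X) T x = polyop p T (T x).
Proof.
rewrite (@polyop_widen (p * 'X) _ _ (size p).+1); last first.
  by apply: leq_trans (size_polyMleq _ _) _; rewrite size_polyX addn2.
rewrite big_ord_recl coefMX/= scale0r add0r.
by apply: eq_bigr => i _; rewrite coefMX/= -iterSr.
Qed.

Lemma polyopX T x : polyop 'X T x = T x.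
Proof. by rewrite -['X]mul1r polyop_mulX -polyC1 polyopC scale1r. Qed.

Lemma polyop_comm p T x : linear T -> polyop p T (T x) = T (polyop p T x).
Proof.
move=> lT; elim/poly_ind: p x => [|p c IH] x.
  by rewrite -polyC0 !polyopC !scale0r (lin0 lT).
by rewrite !polyopD !polyop_mulX !polyopC (linD _ _ lT) (linZ _ _ lT) IH.
Qed.

Lemma polyopM p q T x : linear T ->
  polyop (p * q) T x = polyop p T (polyop q T x).
Proof.
move=> lT; elim/poly_ind: p x => [|p c IH] x.
  by rewrite mul0r -polyC0 !polyopC !scale0r.
rewrite mulrDl !polyopD -mulrA (mulrC 'X) mulrA !polyop_mulX IH -polyop_comm//.
by rewrite mul_polyC polyopZ polyopC.
Qed.

Lemma bounded_polyop p T : bounded_op T -> bounded_op (polyop p T).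
Proof.
move=> bT; elim/poly_ind: p => [|p c IH].
  have := bounded_op_scale 0 (bounded_op_id H); congr bounded_op.
  by apply/funext => x; rewrite -polyC0 polyopC.
have := bounded_op_add (bounded_op_comp IH bT)
  (bounded_op_scale c (bounded_op_id H)).
congr bounded_op; apply/funext => x.
by rewrite polyopD polyop_mulX polyopC.
Qed.

Lemma inverse_polyop_prod (rs : seq R[i]) T : bounded_op T ->
  (forall c, c \in rs -> ~ spectrum T c) ->
  exists V, inverse_op V (polyop (\prod_(c <- rs) ('X - c%:P)) T).
Proof.
move=> bT; elim: rs => [|c rs IH] hrs.
  exists id; split; [exact: bounded_op_id| |] => x;
  by rewrite big_nil -polyC1 polyopC scale1r.
have [V hV] := IH (fun d h => hrs d (@mem_behead _ (c :: rs) d h)).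
have /not_spectrumP [W hW] := hrs c (mem_head _ _).
have := inverse_op_comp hW hV; set F := fun x => _; set G := fun x => _ => FG.
exists F; suff -> : polyop (\prod_(j <- c :: rs) ('X - j%:P)) T = G by [].
apply/funext => x; rewrite big_cons polyopM ?bT.1//; last exact: bT.1.
by rewrite polyopB polyopX polyopC.
Qed.

(** Factor p - c into linear factors over the complex numbers: were all the roots
    outside the spectrum of T, p(T) - c would be a product of invertible operators.
    The nonemptiness of the spectrum covers the case p = c. *)
Lemma spectral_mapping p T c : bounded_op T -> (exists d, spectrum T d) ->
  spectrum (polyop p T) c -> exists2 d, spectrum T d & p.[d] = c.
Proof.
move=> bT [d0 sd0] sc; pose q := p - c%:P.
have [q0|q0] := eqVneq q 0.
  exists d0 => //; have := congr1 (horner^~ d0) q0.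
  by rewrite !hornerE => /eqP; rewrite subr_eq0 => /eqP.
have [rs qE] := closed_field_poly_normal q.
apply: contrapT => h; have [|V hV] := @inverse_polyop_prod rs T bT.
  move=> d drs sd; apply: h; exists d => //.
  have : root q d by rewrite qE rootZ ?lead_coef_eq0// root_prod_XsubC.
  by rewrite /root !hornerE subr_eq0 => /eqP.
have l0 : lead_coef q != 0 by rewrite lead_coef_eq0.
apply: sc; have lQ := (bounded_polyop (\prod_(z <- rs) ('X - z%:P)) bT).1.
have [bW W1 W2] := inverse_op_scale l0 lQ hV.
have qx x : polyop p T x - c *: x =
    lead_coef q *: polyop (\prod_(z <- rs) ('X - z%:P)) T x.
  by rewrite -polyopZ -qE polyopB polyopC.
by eexists; split; [exact: bW|move=> x; rewrite qx; exact: W1|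
  move=> x; rewrite qx; exact: W2].
Qed.

End Polynomials.

Section HilbertPoly.
Variables (R : realType) (H : completeNormedModType R[i]).
Variables (dot : {dot H for (@Num.conj R[i])}) (hH : is_hilbert dot).
Implicit Types (x y z : H) (a b : R) (c : R[i]) (S T V P : H -> H).
Implicit Types (p q : {poly R[i]}).
Local Notation ip := (rdot dot).
Local Notation symop := (symop dot).

(** The polynomial p^* with p^*(P) adjoint to p(P) for symmetric P. *)
Definition conjp p : {poly R[i]} := map_poly (@conjc R) p.

Lemma polyop_conj p P x y : symop P -> bounded_op P ->
  dot (polyop p P x) y = dot x (polyop (conjp p) P y).
Proof.
move=> sP bP; elim/poly_ind: p x y => [|p c IH] x y.
  by rewrite /conjp rmorph0 -polyC0 !polyopC !scale0r linear0l linear0r.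
rewrite /conjp rmorphD rmorphM/= map_polyX map_polyC/= -/(conjp p).
rewrite !polyopD !polyop_mulX !polyopC linearDl linearDr/= dotZl dotZr IH.
by rewrite (polyop_comm _ _ bP.1) sP [conjc (conjc c)]conjcK.
Qed.

(** The supremum of the numerical range of q(P), for q = p^* p, is a value of q on
    the spectrum of P, and q = |p|^2 there because the spectrum is real. *)
Lemma polyop_norm_bound P p K x : bounded_op P -> symop P -> 0 <= K ->
  (forall c, spectrum P c -> complex.Im c = 0) ->
  (forall c, spectrum P c -> normc p.[c] <= K) ->
  nm (polyop p P x) <= K * nm x.
Proof.
move=> bP sP K0 Preal hK.
have bp := bounded_polyop p bP.
pose q := conjp p * p.
have qE z : dot (polyop q P z) z = (nm (polyop p P z) ^+ 2)%:C.
  rewrite /q polyopM; last exact: bP.1.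
  by rewrite dotC -polyop_conj// -(dotC dot) dot_nm.
have qsym : symop (polyop q P).
  move=> y z; rewrite polyop_conj//; congr (dot _ (polyop _ _ _)).
  rewrite /q /conjp rmorphM/= mulrC; congr (_ * _).
  by rewrite -map_poly_comp map_poly_id// => c _ /=; rewrite conjcK.
have [->|x0] := eqVneq x 0; first by rewrite (lin0 bp.1) nm0 mulr0.
have n0 := nm_gt0 x0.
have x1 := nm_normalize x0.
have bq : bounded_op (polyop q P) by exact: bounded_polyop.
have sE : exists d, spectrum P d.
  by eexists; exact: (sup_numrange_spectrum hH bP sP x1).
have [d sd dE] := spectral_mapping bP sE (sup_numrange_spectrum hH bq qsym x1).
have dR : conjc d = d by case: (d) (Preal _ sd) => r s /= ->; rewrite oppr0.
have qd : q.[d] = (normc p.[d] ^+ 2)%:C.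
  rewrite /q hornerM -{1}dR /conjp horner_map /= mulrC; exact: mul_conjc.
have := ip_le_sup_numrange hH bq x1.
move: dE; rewrite qd => /complexI <-.
set u := _ *: x; rewrite /rdot qE /= => h.
have : nm (polyop p P u) <= K.
  rewrite -(@ler_pXn2r _ 2) ?nnegrE ?nm_ge0//; apply: le_trans h _.
  by rewrite ler_pXn2r ?nnegrE ?normc_ge0 ?hK.
rewrite /u (linZ _ _ bp.1) nmZ normcR ger0_norm ?invr_ge0 ?nm_ge0//.
by rewrite mulrC ler_pdivrMr.
Qed.
End HilbertPoly.

(** * Bernstein approximation *)
Section Bernstein.
Variable R : realType.
Implicit Types (g : R -> R) (f : nat -> R) (u a b c e x y K M : R) (p : {poly R}).

(** The Bernstein polynomial with nodes [f 0, ..., f n], in de Casteljau's form.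
    The recursion replaces binomial identities by one-line inductions. *)
Fixpoint bernstein n f : {poly R} :=
  if n is n'.+1 then 'X * bernstein n' (fun k => f k.+1)
                     + (1 - 'X) * bernstein n' f
  else (f 0)%:P.

Lemma bernsteinS n f u : (bernstein n.+1 f).[u] =
  u * (bernstein n (fun k => f k.+1)).[u] + (1 - u) * (bernstein n f).[u].
Proof. by rewrite /= !hornerE. Qed.

Lemma le_bernstein n f1 f2 u : 0 <= u <= 1 ->
  (forall k, (k <= n)%N -> f1 k <= f2 k) ->
  (bernstein n f1).[u] <= (bernstein n f2).[u].
Proof.
move=> /andP[u0 u1]; elim: n f1 f2 => [|n IH] f1 f2 f12.
  by rewrite !hornerE f12.
rewrite !bernsteinS lerD// ler_wpM2l ?subr_ge0// IH// => k kn.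
  exact: f12.
by apply: f12; exact: leqW.
Qed.

(** The mean and variance of the binomial law with parameters n and u. *)
Lemma bernstein_quadratic n a b c u :
  (bernstein n (fun k => a + b * (k%:R - c) ^+ 2)).[u] =
  a + b * (n%:R * u * (1 - u) + (n%:R * u - c) ^+ 2).
Proof.
elim: n c => [|n IH] c; first by rewrite !hornerE; ring.
rewrite bernsteinS IH.
have -> : (fun k : nat => a + b * (k.+1%:R - c) ^+ 2) =
          (fun k : nat => a + b * (k%:R - (c - 1)) ^+ 2).
  by apply/funext => k; rewrite -natr1; ring.
rewrite IH -natr1; ring.
Qed.

(** A form of uniform continuity on [0, M] adapted to Bernstein operators, which
    are monotone and act explicitly on the quadratic right-hand side. *)
Definition quadratic_modulus g M := forall e : R, 0 < e -> exists2 K, 0 <= K &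
  forall x y, 0 <= x <= M -> 0 <= y <= M -> `|g x - g y| <= e + K * (x - y) ^+ 2.

(** Sandwich [g] between two quadratic functions centred at the point of
    evaluation; their Bernstein polynomials differ there from their own values by
    the variance term K M^2 u (1 - u) / (n + 1). *)
Lemma bernstein_approx g M e K n u : 0 < M -> 0 <= K ->
  (forall x y, 0 <= x <= M -> 0 <= y <= M -> `|g x - g y| <= e + K * (x - y) ^+ 2) ->
  0 <= u <= 1 ->
  `|(bernstein n.+1 (fun k => g (M * (k%:R / n.+1%:R)))).[u] - g (M * u)|
    <= e + K * M ^+ 2 * n.+1%:R^-1.
Proof.
move=> M0 K0 hg u01; have /andP[u0 u1] := u01.
set N : R := n.+1%:R; have N0 : 0 < N by rewrite ltr0n.
pose b := K * M ^+ 2 / N ^+ 2.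
have b0 : 0 <= b by rewrite /b !mulr_ge0 ?invr_ge0 ?exprn_ge0 ?(ltW M0) ?(ltW N0).
have err a b' : `|b'| <= b ->
    `|(bernstein n.+1 (fun k => a + b' * (k%:R - N * u) ^+ 2)).[u] - a|
      <= K * M ^+ 2 * N^-1.
  move=> hb; rewrite bernstein_quadratic subrr expr0n addr0 addrAC subrr add0r.
  rewrite normrM; apply: le_trans (_ : b * N <= _); last first.
    by rewrite le_eqVlt; apply/orP; left; apply/eqP; rewrite /b; field; rewrite gt_eqF.
  have v0 : 0 <= N * u * (1 - u) by rewrite !mulr_ge0 ?subr_ge0// ltW.
  rewrite (ger0_norm v0); apply: ler_pM => //.
  rewrite -mulrA ger_pMr// mulrBr mulr1 lerBlDr.
  have := sqr_ge0 u; rewrite expr2; lra.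
have pt k : (k <= n.+1)%N ->
    `|g (M * (k%:R / N)) - g (M * u)| <= e + b * (k%:R - N * u) ^+ 2.
  move=> kn; have -> : b * (k%:R - N * u) ^+ 2 = K * (M * (k%:R / N) - M * u) ^+ 2.
    by rewrite /b; field; rewrite gt_eqF.
  have kN : 0 <= k%:R / N <= 1.
    by rewrite divr_ge0 ?ler0n ?(ltW N0)//= ler_pdivrMr// mul1r ler_nat.
  have sc w : 0 <= w <= 1 -> 0 <= M * w <= M.
    by case/andP=> w0 w1; rewrite mulr_ge0 ?(ltW M0)//= ger_pMr.
  by apply: hg; exact: sc.
clearbody b; clear hg.
rewrite ler_distl; apply/andP; split.
  apply: le_trans (le_bernstein (f1 := fun k => (g (M * u) - e) +
    (- b) * (k%:R - N * u) ^+ 2) u01 _); last first.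
    by move=> k kn; have := pt _ kn; rewrite ler_distl => /andP[+ _] /=; lra.
  have := err (g (M * u) - e) (- b); rewrite normrN ger0_norm// lexx => /(_ isT).
  rewrite ler_distl => /andP[+ _] /=; move: (_.[u]) (K * M ^+ 2 / N) => r s; lra.
apply: le_trans (le_bernstein (f2 := fun k => (g (M * u) + e) +
    b * (k%:R - N * u) ^+ 2) u01 _) _.
  by move=> k kn; have := pt _ kn; rewrite ler_distl => /andP[_ +] /=; lra.
have := err (g (M * u) + e) b; rewrite ger0_norm// lexx => /(_ isT).
rewrite ler_distl => /andP[_ +] /=; move: (_.[u]) (K * M ^+ 2 / N) => r s; lra.
Qed.

Definition uniform_limit (p : nat -> {poly R}) g M := forall e : R, 0 < e ->
  exists N, forall n, (N <= n)%N -> forall x, 0 <= x <= M -> `|(p n).[x] - g x| < e.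

Theorem weierstrass g M : 0 < M -> quadratic_modulus g M ->
  exists p : nat -> {poly R}, uniform_limit p g M.
Proof.
move=> M0 hg.
exists (fun n => bernstein n.+1 (fun k => g (M * (k%:R / n.+1%:R))) \Po (M^-1 *: 'X)).
move=> e e0; have e2 : 0 < e / 2 by rewrite divr_gt0.
have [K K0 hK] := hg _ e2.
have C0 : 0 < K * M ^+ 2 + 1 by rewrite ltr_wpDl// mulr_ge0// exprn_ge0// ltW.
have [N hN] := natinv_lt (divr_gt0 e2 C0).
exists N => n Nn x /andP[x0 xM]; rewrite horner_comp hornerZ hornerX.
have u01 : 0 <= M^-1 * x <= 1.
  by rewrite mulr_ge0 ?invr_ge0 ?(ltW M0)//= ler_pdivrMl// mulr1.
have := bernstein_approx n M0 K0 hK u01.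
rewrite mulrA mulfV ?gt_eqF// mul1r => h; apply: le_lt_trans h _.
have := hN n Nn; rewrite ltr_pdivlMr//.
have : 0 < n.+1%:R^-1 :> R by rewrite invr_gt0 ltr0n.
move: (n.+1%:R^-1) => i i0; rewrite mulrDr mulr1 (mulrC i); lra.
Qed.

End Bernstein.

(** * Scalar inequalities for powers *)
Section PowerModulus.
Variable R : realType.
Implicit Types (e x y v w p s t L M X : R).

(** Convexity: v^p lies above its tangent line at X, multiplied out so that it
    makes sense for X = 0.  It is Young's inequality for v and X^(p-1). *)
Lemma powR_tangent p X v : 1 < p -> 0 <= X -> 0 <= v ->
  p * X `^ (p - 1) * v <= v `^ p + (p - 1) * X `^ p.
Proof.
move=> p1 X0 v0; have p0 : 0 < p by exact: lt_trans p1.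
have q0 : 0 < p - 1 by rewrite subr_gt0.
have := @conjugate_powR R v (X `^ (p - 1)) p (p / (p - 1)) v0 (powR_ge0 _ _) p0
  (divr_gt0 p0 q0).
rewrite -powRrM mulrCA mulfV ?gt_eqF// mulr1 => h.
have {h} : v * X `^ (p - 1) <= v `^ p / p + X `^ p / (p / (p - 1)).
  by apply: h; field; rewrite !gt_eqF.
rewrite -(ler_pM2l p0); congr (_ <= _); first by ring.
by field; rewrite !gt_eqF.
Qed.

(** For y <= x, the tangent line at x bounds x^s - y^s by s x^(s-1) (x - y). *)
Lemma powR_lipschitz s M x y : 1 < s -> 0 <= x <= M -> 0 <= y <= M ->
  `|x `^ s - y `^ s| <= s * M `^ (s - 1) * `|x - y|.
Proof.
move=> s1; have s0 : 0 < s by exact: lt_trans s1.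
wlog yx : x y / y <= x => [h xM yM|/andP[x0 xM] /andP[y0 yM]].
  have [/h|/ltW/h] := leP y x; first exact.
  by rewrite distrC (distrC y); apply.
rewrite !ger0_norm ?subr_ge0//; last by rewrite ge0_ler_powR ?nnegrE// ltW.
have h := powR_tangent s1 x0 y0.
have xs : x `^ s = x * x `^ (s - 1) by rewrite mulr_powRB1.
apply: (@le_trans _ _ (s * x `^ (s - 1) * (x - y))); first by rewrite xs in h *; lra.
apply: ler_wpM2r; first by rewrite subr_ge0.
rewrite ler_pM2l//; apply: ge0_ler_powR; rewrite ?nnegrE ?subr_ge0 ?(ltW s1)//.
exact: le_trans xM.
Qed.

Lemma quadratic_modulus_powR s M : 1 < s -> quadratic_modulus (fun x => x `^ s) M.
Proof.
move=> s1 e e0; pose L := s * M `^ (s - 1).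
exists (L ^+ 2 / (4 * e)).
  by rewrite divr_ge0 ?sqr_ge0// mulr_ge0// ltW.
move=> x y xM yM; apply: le_trans (powR_lipschitz s1 xM yM) _.
rewrite -/L -(real_normK (num_real (x - y))); move: `|x - y| => d.
rewrite -subr_ge0.
have -> : e + L ^+ 2 / (4 * e) * d ^+ 2 - L * d = (2 * e - L * d) ^+ 2 / (4 * e).
  by field; rewrite gt_eqF.
by rewrite divr_ge0 ?sqr_ge0// mulr_ge0// ltW.
Qed.

(** Here w = |sqrt x - sqrt y| satisfies w^4 <= (x - y)^2, and w <= e + w^4 / e^3. *)
Lemma quadratic_modulus_sqrt M : quadratic_modulus (fun x => x `^ 2^-1) M.
Proof.
move=> e e0; exists (e ^- 3); first by rewrite invr_ge0 exprn_ge0// ltW.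
move=> x y /andP[x0 _] /andP[y0 _]; rewrite !powR12_sqrt//.
have := sqrtr_ge0 x; have := sqrtr_ge0 y.
have := sqr_sqrtr x0; have := sqr_sqrtr y0.
move: (Num.sqrt x : R) (Num.sqrt y : R) => a b bE aE b0 a0.
have wd : `|a - b| ^+ 4 <= (x - y) ^+ 2.
  rewrite -aE -bE subr_sqr exprMn (exprM _ 2 2) real_normK ?num_real// expr2.
  apply: ler_wpM2l; first exact: sqr_ge0.
  rewrite -subr_ge0 (_ : _ - _ = 4 * (a * b)); last by ring.
  by rewrite !mulr_ge0.
have e3 : 0 < e ^+ 3 by exact: exprn_gt0.
rewrite mulrC; apply: (@le_trans _ _ (e + `|a - b| ^+ 4 / e ^+ 3)); last first.
  by rewrite lerD2l ler_pM2r ?invr_gt0.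
have := normr_ge0 (a - b); move: (`|a - b| : R) => w w0.
have [we|/ltW ew] := leP w e.
  by rewrite (le_trans we)// lerDl divr_ge0 ?exprn_ge0// ltW.
rewrite ler_wpDl ?(ltW e0)// ler_pdivlMr// (exprS w 3) ler_wpM2l//.
by rewrite lerXn2r ?nnegrE// ltW.
Qed.

Lemma powR_young t X Y : 0 < t < 1 -> 0 <= X -> 0 <= Y ->
  X * Y <= t * X `^ t^-1 + (1 - t) * Y `^ (1 - t)^-1.
Proof.
move=> /andP[t0 t1] X0 Y0; have t1' : 0 < 1 - t by rewrite subr_gt0.
have := @conjugate_powR R X Y t^-1 (1 - t)^-1 X0 Y0.
by rewrite !invr_gt0 !invrK (mulrC t) (mulrC (1 - t)); apply=> //; ring.
Qed.

End PowerModulus.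

(** * Operator norm *)
Section Suprema.
Variable R : realType.
Implicit Types (E : set R) (K : R).

(** The value of [sup] is 0 on sets without a supremum, in particular on the empty
    set, which is the set of norms on unit vectors when [H] is the zero space. *)
Lemma sup_ge0_default E : (forall e, E e -> 0 <= e) -> 0 <= sup E.
Proof.
move=> hE; have [[e Ee]|/forallNP E0] := pselect (E !=set0); last first.
  by rewrite (_ : E = set0) ?sup0//; apply/seteqP; split=> // e /E0.
have [supE|?] := pselect (has_sup E); last by rewrite sup_out.
exact: le_trans (hE e Ee) (ub_le_sup supE.2 Ee).
Qed.

Lemma sup_le_default E K : 0 <= K -> (forall e, E e -> e <= K) -> sup E <= K.
Proof.
move=> K0 hE; have [E0|/forallNP E0] := pselect (E !=set0); first exact: ge_sup.
by rewrite (_ : E = set0) ?sup0//; apply/seteqP; split=> // e /E0.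
Qed.

End Suprema.

Section OperatorNorm.
Variables (R : realType) (H : completeNormedModType R[i]).
Implicit Types (x y z : H) (T : H -> H) (K : R).

Lemma opnorm_ge0 T : 0 <= opnorm T.
Proof. by apply: sup_ge0_default => _ [x _ <-]; exact: nm_ge0. Qed.

Lemma opnorm_le T K : 0 <= K -> (forall x, nm (T x) <= K * nm x) -> opnorm T <= K.
Proof.
move=> K0 TK; apply: sup_le_default => // _ [x /= x1 <-].
by apply: le_trans (TK x) _; rewrite /nm x1 /= mulr1.
Qed.

Lemma unit_nm x : `|x| = 1 <-> nm x = 1.
Proof. by rewrite nmE; split=> [/complexI|->]. Qed.

Lemma le_opnorm T x : bounded_op T -> nm (T x) <= opnorm T * nm x.
Proof.
move=> bT; have [->|x0] := eqVneq x 0; first by rewrite (lin0 bT.1) nm0 mulr0.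
have n0 := nm_gt0 x0.
have [M M0 hM] := bounded_op_nm bT.
rewrite -ler_pdivrMr// mulrC.
have <- : nm (T (((nm x)^-1)%:C *: x)) = (nm x)^-1 * nm (T x).
  by rewrite (linZ _ _ bT.1) nmZ normcR ger0_norm// invr_ge0 nm_ge0.
apply: ub_le_sup; last first.
  by eexists; last reflexivity; apply/unit_nm/nm_normalize.
by exists M => _ [y /= /unit_nm y1 <-]; apply: le_trans (hM y) _; rewrite y1 mulr1.
Qed.

End OperatorNorm.

(** * Continuous functional calculus of a positive operator *)
Section Calculus.
Variables (R : realType) (H : completeNormedModType R[i]).
Variables (dot : {dot H for (@Num.conj R[i])}) (hH : is_hilbert dot).
Implicit Types (x y z : H) (a b e K r s : R) (c : R[i]) (S T V : H -> H).
Implicit Types (p : {poly R}) (g : R -> R).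
Local Notation ip := (rdot dot).
Local Notation symop := (symop dot).

Definition realpoly p : {poly R[i]} := map_poly (real_complex R) p.

Lemma horner_realpoly p a : (realpoly p).[a%:C] = p.[a]%:C.
Proof. exact: horner_map. Qed.

Lemma conjp_realpoly p : conjp (realpoly p) = realpoly p.
Proof.
rewrite /conjp /realpoly -map_poly_comp; apply: eq_map_poly => a /=.
exact: conjc_real.
Qed.

(** Convergence of q_n(P) to T in operator norm, as a bound on each vector. *)
Definition op_limit (q : nat -> {poly R[i]}) P T := forall e, 0 < e ->
  exists N, forall n, (N <= n)%N -> forall x, nm (polyop (q n) P x - T x) <= e * nm x.

Section Positive.
Variables (P : H -> H) (M : R).
Hypotheses (bP : bounded_op P) (sP : symop P).
Hypothesis P0 : forall x, 0 <= ip (P x) x.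
Hypotheses (M0 : 0 < M) (PM : forall x, nm (P x) <= M * nm x).

Lemma polyop_realpoly_bound p K x : 0 <= K ->
  (forall a, 0 <= a <= M -> `|p.[a]| <= K) ->
  nm (polyop (realpoly p) P x) <= K * nm x.
Proof.
move=> K0 hK; apply: (polyop_norm_bound hH) => // c /(spectrum_positive hH bP sP P0 PM).
  by case=> a _ ->.
by case=> a aM ->; rewrite horner_realpoly normcR hK.
Qed.

Lemma symop_realpoly p : symop (polyop (realpoly p) P).
Proof. by move=> x y; rewrite polyop_conj// conjp_realpoly. Qed.

(** If 0 <= p <= K on [0, M], then 0 <= K - p <= K there, hence |K - p(P)| <= K and
    <p(P) x, x> >= 0. *)
Lemma realpoly_ge0 p x : (forall a, 0 <= a <= M -> 0 <= p.[a]) ->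
  0 <= ip (polyop (realpoly p) P x) x.
Proof.
move=> hp; have [K hK] := poly_disk_bound p M.
have K0 : 0 <= K by apply: le_trans (hK 0 _); rewrite ?normr0 ?normr_ge0 ?ltW.
have h : nm (polyop (realpoly (K%:P - p)) P x) <= K * nm x.
  apply: polyop_realpoly_bound => // a aM; have p0 := hp a aM.
  have /andP[a0 aM'] := aM.
  have := hK a; rewrite (ger0_norm a0) (ger0_norm p0) => /(_ aM') pK.
  by rewrite !hornerE ger0_norm ?subr_ge0// gerBl.
have := le_trans (ip_le hH _ _) (ler_wpM2r (nm_ge0 x) h).
rewrite /realpoly rmorphB/= map_polyC/= polyopB polyopC ipBl ipZl ip_nm//.
rewrite -mulrA -expr2; lra.
Qed.

Variable g : R -> R.
Hypothesis hg : quadratic_modulus g M.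

Definition realfun c : R[i] := (g (complex.Re c))%:C.

Definition spectral_limit (q : nat -> {poly R[i]}) := forall e, 0 < e ->
  exists N, forall n, (N <= n)%N -> forall c, spectrum P c ->
    normc ((q n).[c] - realfun c) <= e.

Lemma spectral_limit_close (q1 q2 : nat -> {poly R[i]}) e :
  spectral_limit q1 -> spectral_limit q2 -> 0 < e ->
  exists N, forall m n, (N <= m)%N -> (N <= n)%N -> forall x,
  nm (polyop (q1 m) P x - polyop (q2 n) P x) <= e * nm x.
Proof.
move=> h1 h2 e0; have e2 : 0 < e / 2 by rewrite divr_gt0.
have [N1 hN1] := h1 _ e2; have [N2 hN2] := h2 _ e2.
exists (maxn N1 N2) => m n; rewrite !geq_max => /andP[m1 _] /andP[_ n2] x.
rewrite -polyopB; apply: (polyop_norm_bound hH) => //; first exact: ltW.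
  by move=> c /(spectrum_positive hH bP sP P0 PM) [a _ ->].
move=> c sc; have := hN1 _ m1 _ sc; have := hN2 _ n2 _ sc.
rewrite hornerD hornerN; move: ((q1 m).[c]) ((q2 n).[c]) (realfun c) => u v w.
move=> h h'; have -> : u - v = (u - w) - (v - w) by rewrite opprB addrA subrK.
apply: le_trans (le_normcD _ _) _; rewrite normcN; lra.
Qed.

(** The sequence q_n(P) is Cauchy in operator norm by [polyop_norm_bound]; by
    [spectral_limit_close] every other approximating sequence has the same limit. *)
Lemma spectral_limit_op (q : nat -> {poly R[i]}) : spectral_limit q ->
  exists2 T, bounded_op T &
    forall q', spectral_limit q' -> op_limit q' P T.
Proof.
move=> hq.
have ex x : exists l, tends (fun n => polyop (q n) P x) l.
  apply: cauchy_tends => e e0.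
  have n0 : 0 < nm x + 1 by rewrite ltr_wpDl ?nm_ge0.
  have [N hN] := spectral_limit_close hq hq (divr_gt0 e0 n0).
  exists N => m n Nm Nn; apply: le_lt_trans (hN _ _ Nm Nn x) _.
  by rewrite mulrAC ltr_pdivrMr// ltr_pM2l// ltrDl.
have /choice [T hT] := ex.
have lim q' : spectral_limit q' -> op_limit q' P T.
  move=> hq' e e0; have [N hN] := spectral_limit_close hq' hq e0.
  exists N => n Nn x; apply/ler_addgt0Pr => d d0.
  have [N' hN'] := hT x _ d0.
  apply: le_trans (nm_triangle _ (polyop (q (maxn N N')) P x) _) _.
  by apply: lerD; [apply: hN => //; exact: leq_maxl|apply/ltW/hN'/leq_maxr].
exists T => //.
have [N hN] := lim _ hq 1 ltr01.
have bN := bounded_polyop (q N) bP; have [K K0 hK] := bounded_op_nm bN.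
apply: bounded_opP => [c x y|]; last first.
  exists (K + 1) => x; have -> : T x = polyop (q N) P x - (polyop (q N) P x - T x).
    by rewrite opprB addrC subrK.
  apply: le_trans (nmB _ _) _; rewrite mulrDl lerD//.
  exact: hN.
apply/eqP; rewrite -subr_eq0; apply/eqP/nm_eq0/eqP; rewrite eq_le nm_ge0 andbT.
pose C := nm (c *: x + y) + normc c * nm x + nm y + 1.
have C0 : 0 < C.
  by rewrite /C ltr_wpDl// !addr_ge0 ?mulr_ge0 ?nm_ge0 ?normc_ge0.
apply/ler_addgt0Pl => e e0; rewrite addr0.
have [n hn] := lim _ hq _ (divr_gt0 e0 C0); have {}hn := hn n (leqnn n).
have bn := bounded_polyop (q n) bP.
have -> : T (c *: x + y) - (c *: T x + T y) =
    - (polyop (q n) P (c *: x + y) - T (c *: x + y))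
    + (c *: (polyop (q n) P x - T x) + (polyop (q n) P y - T y)).
  by rewrite bn.1 opprB scalerBr (addrACA (c *: _)) -opprD addrA subrK.
have h1 := hn (c *: x + y); have h2 := hn x; have h3 := hn y.
apply: le_trans (nmD _ _) _; rewrite nmN.
apply: le_trans (lerD h1 (le_trans (nmD _ _) (lerD (lexx _) h3))) _.
rewrite nmZ.
apply: le_trans (lerD (lexx _) (lerD (ler_wpM2l (normc_ge0 c) h2) (lexx _))) _.
have eC : e = e / C * (nm (c *: x + y) + normc c * nm x + nm y + 1).
  by rewrite -/C divfK// gt_eqF.
rewrite [leRHS]eC; have : 0 <= e / C by rewrite divr_ge0 ?ltW.
move: (e / C) => d d0; lra.
Qed.

Lemma op_limit_opnorm (q : nat -> {poly R[i]}) T : bounded_op T -> op_limit q P T ->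
  opnorm (polyop (q n) P \- T) @[n --> \oo] --> (0 : R).
Proof.
move=> bT hT; apply/cvgrPdist_lt => e e0.
have e2 : 0 < e / 2 by rewrite divr_gt0.
have [N hN] := hT _ e2; exists N => // n /= Nn.
rewrite sub0r normrN ger0_norm ?opnorm_ge0//.
apply: le_lt_trans (opnorm_le (ltW e2) (hN n Nn)) _.
by rewrite ltr_pdivrMr// ltr_pMr// ltr1n.
Qed.

Lemma opnorm_op_limit (q : nat -> {poly R[i]}) T : bounded_op T ->
  opnorm (polyop (q n) P \- T) @[n --> \oo] --> (0 : R) -> op_limit q P T.
Proof.
move=> bT /cvgrPdist_lt hT e e0; have [N _ hN] := hT e e0.
exists N => n Nn x; have := hN n Nn.
rewrite /= sub0r normrN ger0_norm ?opnorm_ge0// => h.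
have bn : bounded_op (polyop (q n) P \- T).
  exact: bounded_op_sub (bounded_polyop _ bP) bT.
by apply: le_trans (le_opnorm x bn) _; rewrite ler_wpM2r ?nm_ge0// ltW.
Qed.

(** The Bernstein approximations of [g] show that the calculus is defined at [g]
    and converge to its value. *)
Lemma cfc_limit : bounded_op (cfc P realfun) /\
  exists2 p : nat -> {poly R}, uniform_limit p g M &
    op_limit (fun n => realpoly (p n)) P (cfc P realfun).
Proof.
have [p hp] := weierstrass M0 hg.
have sp : spectral_limit (fun n => realpoly (p n)).
  move=> e e0; have [N hN] := hp e e0; exists N => n Nn c.
  move=> /(spectrum_positive hH bP sP P0 PM) [a aM ->].
  by rewrite horner_realpoly /realfun -rmorphB normcR ltW// hN.
have [T bT hT] := spectral_limit_op sp.
have ex : [set T : H -> H | bounded_op T /\ forall p : nat -> {poly R[i]},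
      (forall e : R, 0 < e -> \forall n \near \oo,
         forall c, spectrum P c -> `|(p n).[c] - realfun c| < e%:C) ->
      opnorm (polyop (p n) P \- T) @[n --> \oo] --> (0 : R)] !=set0.
  exists T; split=> // q hq; apply: op_limit_opnorm => //; apply: hT.
  move=> e e0; have [N _ hN] := hq e e0.
  by exists N => n Nn c sc; rewrite -lecR; apply/ltW/hN.
have [bC hC] := getPex ex; split=> //; exists p => //.
apply: opnorm_op_limit => //; apply: hC => e e0.
have [N hN] := hp e e0; exists N => // n Nn c.
move=> /(spectrum_positive hH bP sP P0 PM) [a aM ->].
by rewrite horner_realpoly /realfun -rmorphB norm_normc normcR ltcR hN.
Qed.

Lemma symop_op_limit (p : nat -> {poly R}) T :
  op_limit (fun n => realpoly (p n)) P T -> symop T.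
Proof.
move=> hT x y; apply/eqP; rewrite -subr_eq0; apply/eqP/eq0_normc/eqP.
rewrite eq_le normc_ge0 andbT; apply/ler_addgt0Pl => e e0; rewrite addr0.
pose C := 2 * (nm x * nm y) + 1.
have C0 : 0 < C by rewrite ltr_wpDl// !mulr_ge0 ?nm_ge0.
have [n hn] := hT _ (divr_gt0 e0 C0); have {}hn := hn n (leqnn n).
have -> : dot (T x) y - dot x (T y) =
    dot x (polyop (realpoly (p n)) P y - T y) -
    dot (polyop (realpoly (p n)) P x - T x) y.
  by rewrite linearBl linearBr/= symop_realpoly; ring.
apply: le_trans (le_normcD _ _) _; rewrite normcN.
apply: le_trans (lerD (dot_le hH _ _) (dot_le hH _ _)) _.
apply: le_trans (lerD (ler_wpM2l (nm_ge0 x) (hn y)) (ler_wpM2r (nm_ge0 y) (hn x))) _.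
have eC : e = e / C * (2 * (nm x * nm y) + 1) by rewrite -/C divfK// gt_eqF.
rewrite [leRHS]eC; have : 0 <= e / C by rewrite divr_ge0 ?ltW.
move: (e / C) => d d0; lra.
Qed.

(** Positivity of the calculus: if g + h >= 0 on [0, M], then g(P) + h(P) >= 0.  The
    polynomials p_n + h + d, for an error d, are nonnegative on [0, M], so
    [realpoly_ge0] applies to them. *)
Lemma limit_add_poly_ge0 (p : nat -> {poly R}) (h : {poly R}) T x :
  uniform_limit p g M -> op_limit (fun n => realpoly (p n)) P T ->
  (forall a, 0 <= a <= M -> 0 <= g a + h.[a]) ->
  0 <= ip (T x) x + ip (polyop (realpoly h) P x) x.
Proof.
move=> hp hT gh; apply/ler_addgt0Pl => e e0.
pose C := nm x ^+ 2 + 1.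
have C0 : 0 < C by rewrite ltr_wpDl// sqr_ge0.
have d0 : 0 < e / (2 * C) by rewrite divr_gt0// mulr_gt0.
have : e / (2 * C) * nm x ^+ 2 <= e / 2.
  rewrite mulrAC ler_pdivrMr//; last by rewrite mulr_gt0.
  have -> : e / 2 * (2 * C) = e * C by field.
  by rewrite ler_pM2l// lerDl.
move: (e / (2 * C)) d0 => d d0 dC.
have [N1 hN1] := hT _ d0; have [N2 hN2] := hp _ d0.
pose n := maxn N1 N2.
have := hN1 n (leq_maxl _ _) x; have {}hN2 := hN2 n (leq_maxr _ _) => h2.
have := le_trans (ip_le hH (polyop (realpoly (p n)) P x - T x) x)
   (ler_wpM2r (nm_ge0 x) h2).
rewrite ipBl -mulrA -expr2.
have : 0 <= ip (polyop (realpoly (p n + h + d%:P)) P x) x.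
  apply: realpoly_ge0 => a aM; have := gh _ aM; have := hN2 _ aM.
  by rewrite !hornerE ltr_distl => /andP[+ _]; lra.
rewrite /realpoly !rmorphD/= map_polyC/= !polyopD polyopC !ipDl ipZl ip_nm//.
lra.
Qed.

End Positive.

End Calculus.

(** * Square roots, McCarthy's inequality and the theorem *)
Section AbsoluteValue.
Variables (R : realType) (H : completeNormedModType R[i]).
Variables (dot : {dot H for (@Num.conj R[i])}) (hH : is_hilbert dot).
Implicit Types (x y z : H) (a b e K r s : R) (c : R[i]) (S T V : H -> H).
Local Notation ip := (rdot dot).
Local Notation symop := (symop dot).

Section Positive.
Variables (P : H -> H).
Hypotheses (bP : bounded_op P) (sP : symop P).
Hypothesis P0 : forall x, 0 <= ip (P x) x.

(** If p_n tends to the square root uniformly on [0, M], then p_n^2 - X tends to 0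
    there, so p_n(P)^2 tends to P in norm, while it also tends to B^2. *)
Lemma oppow_half_sqr : let B := oppow P 2^-1 in
  [/\ bounded_op B, symop B, forall x, 0 <= ip (B x) x & forall x, B (B x) = P x].
Proof.
move=> B; have [M M0 PM] := bounded_op_nm bP.
have [bB [p hp hB]] := cfc_limit hH bP sP P0 M0 PM (@quadratic_modulus_sqrt R M).
rewrite -[cfc _ _]/B in bB hB.
have sB : symop B by exact: symop_op_limit hB.
split=> // x.
  have := limit_add_poly_ge0 hH bP sP P0 M0 PM x hp hB (h := 0).
  rewrite /realpoly rmorph0 -polyC0 polyopC scale0r {2}/rdot linear0l addr0; apply.
  by move=> a _; rewrite polyC0 horner0 addr0 powR_ge0.
have [K K0 hK] := bounded_op_nm bB.
apply/eqP; rewrite -subr_eq0; apply/eqP/nm_eq0/eqP.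
rewrite eq_le nm_ge0 andbT leNgt; apply/negP => y0.
set y := nm _ in y0.
(* [C] bounds |B (B x) - P x| / d when both |p_n - sqrt| and |p_n(P) - B| are at
   most [d <= 1]: the three summands come from p_n(P)^2 - P, p_n(P) (B - p_n(P)) and
   (B - p_n(P)) B. *)
pose C := (1 + 2 * Num.sqrt M + (K + 1) + K) * nm x.
have C0 : 0 <= C.
  by rewrite mulr_ge0 ?nm_ge0// !addr_ge0 ?mulr_ge0 ?sqrtr_ge0 ?(ltW K0).
have [d [d0 d1 dC]] : exists d : R, [/\ 0 < d, d <= 1 & d * C < y].
  have D0 : 0 < C + y + 1 by lra.
  exists (y / (C + y + 1)); split; first exact: divr_gt0.
    by rewrite ler_pdivrMr//; lra.
  by rewrite mulrAC ltr_pdivrMr// ltr_pM2l//; lra.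
have [N1 hN1] := hp _ d0; have [N2 hN2] := hB _ d0.
pose n := maxn N1 N2.
have {}hN1 := hN1 n (leq_maxl _ _); have {}hN2 := hN2 n (leq_maxr _ _).
set Q := polyop (realpoly (p n)) P in hN2.
have bQ : bounded_op Q by exact: bounded_polyop.
have QK z : nm (Q z) <= (K + 1) * nm z.
  have -> : Q z = (Q z - B z) + B z by rewrite subrK.
  apply: le_trans (nmD _ _) _; have := hN2 z; have := hK z.
  have := ler_wpM2r (nm_ge0 z) d1; lra.
have QQ : nm (Q (Q x) - P x) <= d * (1 + 2 * Num.sqrt M) * nm x.
  have -> : Q (Q x) - P x = polyop (realpoly (p n * p n - 'X)) P x.
    rewrite /realpoly rmorphB rmorphM/= map_polyX.
    by rewrite polyopB polyopM ?polyopX//; exact: bP.1.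
  have sM := sqrtr_ge0 M.
  apply: (polyop_realpoly_bound hH bP sP P0 PM) => [|a aM].
    by rewrite mulr_ge0 ?(ltW d0)// addr_ge0// mulr_ge0.
  have /andP[a0 aM'] := aM.
  have := hN1 _ aM; rewrite powR12_sqrt// !hornerE; have := sqr_sqrtr a0.
  have : Num.sqrt a <= Num.sqrt M by rewrite ler_sqrt// ltW.
  have := sqrtr_ge0 a; move: (Num.sqrt a : R) ((p n).[a]) => u v u0 uM <- vu.
  have -> : v * v - u ^+ 2 = (v - u) * (v + u) by ring.
  rewrite normrM; apply: ler_pM => //; first exact: ltW.
  have -> : v + u = (v - u) + 2 * u by ring.
  apply: le_trans (ler_normD _ _) _; rewrite (ger0_norm (_ : 0 <= 2 * u)) ?mulr_ge0//.
  lra.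
suff : y <= d * C by rewrite leNgt dC.
have h1 : nm (B (B x) - Q (B x)) <= d * (K * nm x).
  rewrite nmBC; apply: le_trans (hN2 _) _; rewrite ler_pM2l//.
have h2 : nm (Q (B x) - Q (Q x)) <= (K + 1) * (d * nm x).
  rewrite -(linB _ _ bQ.1); apply: le_trans (QK _) _.
  by apply: ler_wpM2l; [rewrite addr_ge0// ltW|rewrite nmBC].
apply: le_trans (nm_triangle _ (Q (B x)) _) _.
apply: le_trans (lerD (lexx _) (nm_triangle _ (Q (Q x)) _)) _.
apply: le_trans (lerD h1 (lerD h2 QQ)) _.
rewrite /C; lra.
Qed.

(** With X = |P x|^2, the function u^(2s) + (s-1) X^s - s X^(s-1) u^2 is nonnegative by
    [powR_tangent] at v = u^2; so is its value at P, whose quadratic form at a unit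
    vector x is <P^(2s) x, x> - X^s. *)
Lemma oppow_jensen s : 1 < s -> bounded_op (oppow P (2 * s)) /\
  forall x, nm x = 1 -> (nm (P x) ^+ 2) `^ s <= ip (oppow P (2 * s) x) x.
Proof.
move=> s1; have [M M0 PM] := bounded_op_nm bP.
have s2 : 1 < 2 * s by lra.
have [bQ [p hp hQ]] := cfc_limit hH bP sP P0 M0 PM (@quadratic_modulus_powR R _ M s2).
rewrite -[cfc _ _]/(oppow P (2 * s)) in bQ hQ.
split=> // x x1; set X := nm (P x) ^+ 2.
have X0 : 0 <= X by exact: sqr_ge0.
pose h : {poly R} := ((s - 1) * X `^ s)%:P - (s * X `^ (s - 1)) *: 'X^2.
have := limit_add_poly_ge0 hH bP sP P0 M0 PM x hp hQ (h := h).
have -> : ip (polyop (realpoly h) P x) x = - X `^ s.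
  rewrite /realpoly /h rmorphB/= map_polyC/= map_polyZ/= map_polyXn.
  rewrite polyopB polyopC polyopZ expr2 polyopM; last exact: bP.1.
  rewrite !polyopX ipBl !ipZl symop_ip// !ip_nm// x1 expr1n -/X.
  have XX : X `^ (s - 1) * X = X `^ s by rewrite mulrC mulr_powRB1//; lra.
  by rewrite -(mulrA s) XX; ring.
rewrite subr_ge0; apply => a /andP[a0 _].
rewrite /h hornerD hornerN hornerZ hornerXn hornerC.
have -> : a `^ (2 * s) = (a ^+ 2) `^ s by rewrite powRrM powR_mulrn.
have := powR_tangent s1 X0 (sqr_ge0 a); lra.
Qed.
End Positive.

(** This is [oppow_jensen] for |T|, since |T|^2 = T^* T gives | |T| x | = |T x|. *)
Lemma absop_jensen T s : bounded_op T -> 1 < s ->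
  bounded_op (oppow (absop dot T) (2 * s)) /\
  forall x, nm x = 1 ->
    (nm (T x) ^+ 2) `^ s <= ip (oppow (absop dot T) (2 * s) x) x.
Proof.
move=> bT s1; have bA := bounded_op_adjoint hH bT.
have bP : bounded_op (adjoint dot T \o T) by exact: bounded_op_comp.
have sP : symop (adjoint dot T \o T).
  by move=> x y /=; rewrite adjointPr// adjointP.
have P0 x : ip ((adjoint dot T \o T) x) x = nm (T x) ^+ 2.
  by rewrite -(ip_nm hH) /rdot /= adjointPr.
have [|bB sB B0 BB] := oppow_half_sqr bP sP _.
  by move=> x; rewrite P0 sqr_ge0.
rewrite -/(absop dot T) in bB sB B0 BB.
have [bQ hQ] := oppow_jensen bB sB B0 s1; split=> // x x1.
have <- : nm (absop dot T x) ^+ 2 = nm (T x) ^+ 2; last exact: hQ.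
by rewrite -P0 -BB -(ip_nm hH) (symop_ip (absop dot T x) x sB).
Qed.

(** The map y |-> 2 <y, x> x - y is the reflection in the line of x, hence an isometry;
    Cauchy-Schwarz for the reflected vector and z gives the claim. *)
Lemma buzano x y z : nm x = 1 ->
  2 * normc (dot y x * dot x z) <= nm y * nm z + normc (dot y z).
Proof.
move=> x1; set c := dot y x; pose u := (2%:C * c) *: x - y.
have nu : nm u = nm y.
  apply/eqP; rewrite -(@eqrXn2 _ 2) ?nm_ge0//; apply/eqP.
  rewrite (nm_sqrB hH) nmZ x1 mulr1 normcM normcR /rdot dotZl -mulrA (dotC dot y x).
  by rewrite mul_conjc -/c cReZ /= exprMn ger0_norm//; ring.
have -> : 2 * normc (c * dot x z) = normc (dot u z + dot y z).
  by rewrite /u linearBl/= subrK dotZl -mulrA [RHS]normcM normcR ger0_norm.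
rewrite -nu; apply: le_trans (lerD (dot_le hH u z) (lexx _)).
exact: le_normcD.
Qed.

Lemma le_numrad T x : bounded_op T -> nm x = 1 -> normc (dot (T x) x) <= numrad dot T.
Proof.
move=> bT x1; have [M M0 hM] := bounded_op_nm bT.
apply: ub_le_sup; last by exists x => //; apply/unit_nm.
exists M => _ [y /= /unit_nm y1 <-]; apply: le_trans (dot_le hH _ _) _.
by rewrite y1 mulr1 (le_trans (hM y))// y1 mulr1.
Qed.

Lemma numrad_ge0 T : 0 <= numrad dot T.
Proof. by apply: sup_ge0_default => _ [x _ <-]; exact: normc_ge0. Qed.

Lemma numrad_sqr_le T K : 0 <= K ->
  (forall x, nm x = 1 -> normc (dot (T x) x) ^+ 2 <= K) -> numrad dot T ^+ 2 <= K.
Proof.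
move=> K0 TK; rewrite -(sqr_sqrtr K0) ler_pXn2r ?nnegrE ?numrad_ge0 ?sqrtr_ge0//.
apply: sup_le_default; first exact: sqrtr_ge0.
move=> _ [x /= /unit_nm x1 <-]; change (normc (dot (T x) x) <= Num.sqrt K).
by rewrite -(ger0_norm (normc_ge0 _)) -sqrtr_sqr ler_sqrt// TK.
Qed.

(** Young's inequality for |T x|^2 and |T^* x|^2, then McCarthy's
    inequality for each. *)
Lemma norm_mul_adjoint_le T t x : bounded_op T -> 0 < t < 1 -> nm x = 1 ->
  nm (T x) * nm (adjoint dot T x) <=
  Num.sqrt (opnorm (fun y : H =>
     t%:C *: oppow (absop dot T) (2 / t) y
     + (1 - t)%:C *: oppow (absop dot (adjoint dot T)) (2 / (1 - t)) y)).
Proof.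
move=> bT t01 x1; have /andP[t0 t1] := t01; set W := fun y => _.
have t0' : 0 < 1 - t by rewrite subr_gt0.
have [|b1 h1] := absop_jensen bT (s := t^-1); first by rewrite invf_gt1.
have [|b2 h2] := absop_jensen (bounded_op_adjoint hH bT) (s := (1 - t)^-1).
  by rewrite invf_gt1//; lra.
have bW : bounded_op W by apply: bounded_op_add; exact: bounded_op_scale.
have -> : nm (T x) * nm (adjoint dot T x) =
    Num.sqrt (nm (T x) ^+ 2 * nm (adjoint dot T x) ^+ 2).
  by rewrite -exprMn sqrtr_sqr ger0_norm// mulr_ge0 ?nm_ge0.
rewrite ler_sqrt ?opnorm_ge0//.
apply: le_trans (powR_young t01 (sqr_ge0 _) (sqr_ge0 _)) _.
apply: (@le_trans _ _ (ip (W x) x)).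
  by rewrite /W ipDl !ipZl lerD// ler_pM2l// ?h1 ?h2.
apply: le_trans (ip_le hH _ _) _; rewrite x1 mulr1.
by apply: le_trans (le_opnorm x bW) _; rewrite x1 mulr1.
Qed.

End AbsoluteValue.

Theorem corollary3p2 (R : realType) (H : completeNormedModType R[i])
    (dot : {dot H for (@Num.conj R[i])}) (hH : is_hilbert dot)
    (A : H -> H) (hA : bounded_op A) :
  numrad dot A ^+ 2 <= 2^-1 *
    inf [set Num.sqrt (opnorm (fun x : H =>
               t%:C *: oppow (absop dot A) (2 / t) x
               + (1 - t)%:C *: oppow (absop dot (adjoint dot A)) (2 / (1 - t)) x))
             + numrad dot (A \o A)
        | t in [set t : R | 0 < t < 1]].
Proof.
rewrite -ler_pdivrMl ?invr_gt0// invrK; apply: lb_le_inf.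
  by eexists; exists 2^-1 => //=; lra.
move=> _ [t /= t01 <-]; rewrite -ler_pdivlMl//.
apply: numrad_sqr_le => [|x x1].
  by rewrite mulr_ge0 ?invr_ge0// addr_ge0 ?sqrtr_ge0 ?numrad_ge0.
have := buzano hH (A x) (adjoint dot A x) x1.
rewrite -!adjointP// normcM -expr2 => h.
have := norm_mul_adjoint_le hH hA t01 x1.
have := le_numrad hH (bounded_op_comp hA hA) x1.
rewrite -ler_pdivrMl ?invr_gt0// invrK => h1 h2.
by apply: le_trans h _; apply: lerD.
Qed.
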